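(* Fix $q\in(-\infty,0)\cup(1,\infty)$. Let $\mathcal{Q}^q\neq\varnothing$ and suppose that the following condition $(\mathcal{C}_q)$ holds: there exists $\widetilde\lambda_q\in\mathbb{R}^d$ such that $\widetilde Y_q(x):=((q-1)\widetilde\lambda_q^*x+1)^{1/(q-1)}>0$ for $K$-a.e. $x$ and, with $\widetilde\beta_q:=\widetilde\lambda_q$, $$\int_{\mathbb{R}^d}|x\widetilde Y_q(x)-h(x)|\,K(dx)<\infty,\qquad b+c\widetilde\beta_q+\int_{\mathbb{R}^d}(x\widetilde Y_q(x)-h(x))\,K(dx)=0.$$ Then $(\widetilde\beta_q,\widetilde Y_q)$ solves the problem $(\mathcal{P}_q)$: minimize $$k_q(\beta,Y)=\frac{q(q-1)}{2}\beta^*c\beta+\int_{\mathbb{R}^d}g_q(Y(x))\,K(dx),\qquad g_q(y)=y^q-1-q(y-1),$$ over the set $\mathcal{A}_q$ of all pairs $(\beta,Y)$ such that $\beta\in\mathbb{R}^d$, $Y:\mathbb{R}^d\to\mathbb{R}_+$ is measurable with $Y>0$ $K$-a.e., $k_q(\beta,Y)<\infty$, and $$\int_{\mathbb{R}^d}|xY(x)-h(x)|\,K(dx)<\infty,\qquad b+c\beta+\int_{\mathbb{R}^d}(xY(x)-h(x))\,K(dx)=0.$$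
   Context: Setting. $T\in(0,\infty)$ is a finite time horizon; $(\Omega,\mathcal{F},\mathbb{F},P)$ is a filtered probability space, where $\mathbb{F}=(\mathcal{F}_t)_{0\le t\le T}$ is the $P$-augmentation of the filtration generated by a $d$-dimensional $P$-Lévy process $L=(L_t)_{0\le t\le T}$ with $L_0=0$. $L$ has characteristic triplet $(b,c,K)$ with respect to the truncation function $h(x)=x\mathbf{1}_{\{\|x\|\le 1\}}$ ($b\in\mathbb{R}^d$, $c$ a symmetric nonnegative definite $d\times d$ matrix, $K$ the Lévy measure, $K(\{0\})=0$). $S=\mathcal{E}(L)=(\mathcal{E}(L^1),\dots,\mathcal{E}(L^d))^*$ is the componentwise stochastic exponential, assumed strictly positive, i.e. $\Delta L^i>-1$ $P$-a.s. for $i=1,\dots,d$. Here ${}^*$ on a vector denotes transpose and $E[\cdot]$ expectation under $P$. $\mathcal{M}^e(S)$ is the set of probability measures $Q\approx P$ under which $S$ is a local martingale. For $Q\ll P$, $Z^Q_t=E[dQ/dP\,|\,\mathcal{F}_t]$ is its density process and $f^q(Q|P):=E[(Z^Q_T)^q]$. Put $\mathcal{Q}^q:=\{Q\in\mathcal{M}^e(S)\mid f^q(Q|P)<\infty\}$. All functions on $\mathbb{R}^d$ that are $K$-a.e. equal are identified (so $\widetilde Y_q$ only needs to be defined and positive $K$-a.e.). *)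

(* Defs.v *)
From HB Require Import structures.
From mathcomp Require Import all_boot all_order all_algebra.
From mathcomp Require Import all_classical all_reals all_analysis.
Import Order.TTheory GRing.Theory Num.Theory.
Import numFieldNormedType.Exports.

Set Implicit Arguments.
Unset Strict Implicit.
Unset Printing Implicit Defensive.

Local Open Scope classical_set_scope.
Local Open Scope ring_scope.

(* The Borel sigma-algebra of the finite-dimensional space 'M[R]_(m, n), in
   particular of R^d = 'cV[R]_d. *)
Section borel_matrix.
Context (R : realType) (m n : nat).

Definition borel_mx : set (set 'M[R]_(m, n)) :=
  <<s (@open 'M[R]_(m, n)) >>.

Lemma borel_mx0 : borel_mx set0.
Proof. exact: sigma_algebra0. Qed.

Lemma borel_mxC A : borel_mx A -> borel_mx (~` A).
Proof. exact: sigma_algebraC. Qed.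

Lemma borel_mx_bigcup (F : (set 'M[R]_(m, n))^nat) :
  (forall i, borel_mx (F i)) -> borel_mx (\bigcup_i (F i)).
Proof. exact: sigma_algebra_bigcup. Qed.

HB.instance Definition _ := @isMeasurable.Build
  (sigma_display (@open 'M[R]_(m, n))) 'M[R]_(m, n)
  borel_mx borel_mx0 borel_mxC borel_mx_bigcup.

End borel_matrix.

Section euclidean.
Context (R : realType) (d : nat).
Implicit Types u x : 'cV[R]_d.

Definition dot u x : R := \sum_(i < d) u i ord0 * x i ord0.

(* The library norm on matrices is the sup norm. *)
Definition enorm x : R := Num.sqrt (dot x x).

Definition trunc x : 'cV[R]_d := if enorm x <= 1 then x else 0.

Definition sym_psd (c : 'M[R]_d) : Prop :=
  c^T = c /\ forall u, 0 <= dot u (c *m u).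

Definition levy_measure (K : {measure set 'cV[R]_d -> \bar R}) : Prop :=
  K [set 0] = 0%E /\
  (\int[K]_x (Num.min 1 (enorm x ^+ 2))%:E < +oo)%E.

Definition vec_integral (K : {measure set 'cV[R]_d -> \bar R})
    (f : 'cV[R]_d -> 'cV[R]_d) : 'cV[R]_d :=
  \col_i (\int[K]_x (f x i ord0)).

(* Real and imaginary parts of the Levy-Khintchine exponent
   i u.b - u.cu / 2 + \int (e^{i u.x} - 1 - i u.h(x)) K(dx). *)
Definition exponent_re (c : 'M[R]_d) (K : {measure set 'cV[R]_d -> \bar R}) u : R :=
  - (dot u (c *m u) / 2) + \int[K]_x (cos (dot u x) - 1).

Definition exponent_im (b : 'cV[R]_d) (K : {measure set 'cV[R]_d -> \bar R}) u : R :=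
  dot u b + \int[K]_x (sin (dot u x) - dot u (trunc x)).

End euclidean.

(* Only the restriction of a path to [0, T] is relevant. *)
Section paths.
Context (R : realType) (T : R).
Implicit Type x : R -> R.

Definition cadlag x : Prop :=
  (forall t, 0 <= t < T -> x @ t^'+ --> x t) /\
  (forall t, 0 < t <= T -> cvg (x @ t^'-)).

Definition jump x (t : R) : R := x t - lim (x @ t^'-).

End paths.

Section processes.
Context (R : realType) (dO : measure_display) (Omega : measurableType dO).
Implicit Types (P Q : probability Omega R) (G : set (set Omega)).

Definition coordinate d (X : R -> Omega -> 'cV[R]_d) (i : 'I_d) : R -> Omega -> R :=
  fun t w => X t w i ord0.

(* P-augmentation of the filtration generated by X: every subset of a P-null
   event is adjoined. *)
Definition augmented_filtration P d (X : R -> Omega -> 'cV[R]_d) (t : R) :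
    set (set Omega) :=
  <<s [set A | (exists (s : R) (B : set 'cV[R]_d),
                   [/\ 0 <= s <= t, measurable B & A = X s @^-1` B])
               \/ P.-negligible A] >>.

Definition measurable_wrt G dV (V : measurableType dV) (f : Omega -> V) : Prop :=
  forall B, measurable B -> G (f @^-1` B).

Definition adapted (F : R -> set (set Omega)) (T : R) dV (V : measurableType dV)
    (X : R -> Omega -> V) : Prop :=
  forall t, 0 <= t <= T -> measurable_wrt (F t) (X t).

Definition levy_process P (F : R -> set (set Omega)) (T : R) d
    (L : R -> Omega -> 'cV[R]_d) : Prop :=
  [/\ adapted F T L,
      {ae P, forall w, L 0 w = 0},
      {ae P, forall w, forall i, cadlag T (fun t => coordinate L i t w)},
      (forall (s t : R) A (B : set 'cV[R]_d),
        0 <= s <= t -> t <= T -> F s A -> measurable B ->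
        P (A `&` (fun w => L t w - L s w) @^-1` B) =
        (P A * P ((fun w => L t w - L s w)%R @^-1` B))%E) &
      (forall (s t : R) (B : set 'cV[R]_d),
        0 <= s <= t -> t <= T -> measurable B ->
        P ((fun w => L t w - L s w) @^-1` B) = P (L (t - s) @^-1` B))].

(* Levy-Khintchine formula: E[e^{i u.L_t}] = e^{t psi(u)}, split into real and
   imaginary parts. *)
Definition levy_triplet P (T : R) d (L : R -> Omega -> 'cV[R]_d)
    (b : 'cV[R]_d) (c : 'M[R]_d) (K : {measure set 'cV[R]_d -> \bar R}) : Prop :=
  forall t u, 0 <= t <= T ->
    \int[P]_w (cos (dot u (L t w))) =
      expR (t * exponent_re c K u) * cos (t * exponent_im b K u) /\
    \int[P]_w (sin (dot u (L t w))) =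
      expR (t * exponent_re c K u) * sin (t * exponent_im b K u).

(* p n 0 <= ... <= p n (N n), n >= 0, is a sequence of partitions of [0, t] with
   mesh tending to 0. *)
Definition vanishing_partitions (t : R) (N : nat -> nat) (p : nat -> nat -> R) :
    Prop :=
  (forall n, [/\ p n 0%N = 0, p n (N n) = t &
                 forall k, (k < N n)%N -> p n k <= p n k.+1]) /\
  (forall e, 0 < e -> \forall n \near \oo,
     forall k, (k < N n)%N -> p n k.+1 - p n k <= e).

(* I_t = \int_0^t H_{s-} dX_s for 0 <= t <= T, as limit in probability of
   left-endpoint Riemann sums.  For an adapted cadlag H and a semimartingale X
   (such as a Levy process) this limit exists and is the stochastic integral. *)
Definition stoch_integral P (T : R) (H X I : R -> Omega -> R) : Prop :=
  forall t N p, 0 <= t <= T -> vanishing_partitions t N p ->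
  forall e : R, 0 < e ->
    P [set w | e <= `| \sum_(k < N n) H (p n k) w * (X (p n k.+1) w - X (p n k) w)
                       - I t w |] @[n --> \oo] --> 0%E.

(* E is the stochastic exponential of X: E_t = 1 + \int_0^t E_{s-} dX_s. *)
Definition stoch_exponential P (F : R -> set (set Omega)) (T : R)
    (X E : R -> Omega -> R) : Prop :=
  [/\ adapted F T E,
      {ae P, forall w, cadlag T (fun t => E t w)} &
      stoch_integral P T E X (fun t w => E t w - 1)].

(* Y is a version of the conditional expectation E_P[X | G]. *)
Definition cond_exp P G (X : Omega -> \bar R) (Y : Omega -> R) : Prop :=
  [/\ measurable_wrt G Y,
      P.-integrable setT (EFin \o Y) &
      forall A, G A -> (\int[P]_(w in A) (Y w)%:E = \int[P]_(w in A) X w)%E].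

Definition martingale P (F : R -> set (set Omega)) (T : R)
    (M : R -> Omega -> R) : Prop :=
  [/\ adapted F T M,
      {ae P, forall w, cadlag T (fun t => M t w)},
      (forall t, 0 <= t <= T -> P.-integrable setT (EFin \o M t)) &
      forall s t, 0 <= s <= t -> t <= T -> cond_exp P (F s) (EFin \o M t) (M s)].

Definition stopping_time (F : R -> set (set Omega)) (T : R) (tau : Omega -> R) :
    Prop :=
  (forall w, 0 <= tau w <= T) /\
  (forall t, 0 <= t <= T -> F t [set w | tau w <= t]).

Definition stopped (M : R -> Omega -> R) (tau : Omega -> R) : R -> Omega -> R :=
  fun t w => M (Num.min t (tau w)) w.

Definition local_martingale P (F : R -> set (set Omega)) (T : R)
    (M : R -> Omega -> R) : Prop :=
  adapted F T M /\
  exists tau : nat -> Omega -> R,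
    [/\ forall n, stopping_time F T (tau n),
        {ae P, forall w, forall n, tau n w <= tau n.+1 w},
        {ae P, forall w, exists n, tau n w = T} &
        forall n, martingale P F T
          (fun t w => stopped M (tau n) t w - M 0 w)].

(* M^e(S): probability measures Q equivalent to P such that S is a local
   Q-martingale. *)
Definition equivalent_lmm P (F : R -> set (set Omega)) (T : R) d
    (S : R -> Omega -> 'cV[R]_d) : set (probability Omega R) :=
  [set Q : probability Omega R | [/\ Q `<< P, P `<< Q &
               forall i, local_martingale Q F T (coordinate S i)]].

Definition density_process P (F : R -> set (set Omega)) (T : R) Q
    (Z : R -> Omega -> R) : Prop :=
  forall t, 0 <= t <= T ->
    cond_exp P (F t) (Radon_Nikodym (charge_of_finite_measure Q) P) (Z t).

(* Q^q; f^q(Q|P) = E_P[(Z_T)^q] does not depend on the version Z of the density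
   process.  For Q equivalent to P, Z_T > 0 a.s., so that the value of powR
   outside of ]0, +oo[ is irrelevant. *)
Definition finite_fq_lmm P (F : R -> set (set Omega)) (T : R) d
    (S : R -> Omega -> 'cV[R]_d) (q : R) : set (probability Omega R) :=
  [set Q : probability Omega R | equivalent_lmm P F T S Q /\
           exists Z, density_process P F T Q Z /\
                     (\int[P]_w ((Z T w) `^ q)%:E < +oo)%E].

End processes.

Section problem.
Context (R : realType) (d : nat).
Context (b : 'cV[R]_d) (c : 'M[R]_d) (K : {measure set 'cV[R]_d -> \bar R}).
Context (q : R).

Definition gq (y : R) : R := y `^ q - 1 - q * (y - 1).

Definition kq (beta : 'cV[R]_d) (Y : 'cV[R]_d -> R) : \bar R :=
  ((q * (q - 1) / 2 * dot beta (c *m beta))%:E + \int[K]_x (gq (Y x))%:E)%E.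

Definition martingale_condition (beta : 'cV[R]_d) (Y : 'cV[R]_d -> R) : Prop :=
  (\int[K]_x (enorm (Y x *: x - trunc x))%:E < +oo)%E /\
  b + c *m beta + vec_integral K (fun x => Y x *: x - trunc x) = 0.

Definition admissible : set ('cV[R]_d * ('cV[R]_d -> R)) :=
  [set bY : 'cV[R]_d * ('cV[R]_d -> R) |
    [/\ measurable_fun setT bY.2,
        forall x, 0 <= bY.2 x,
        {ae K, forall x, 0 < bY.2 x},
        (kq bY.1 bY.2 < +oo)%E &
        martingale_condition bY.1 bY.2]].

Definition solves (bY : 'cV[R]_d * ('cV[R]_d -> R)) : Prop :=
  admissible bY /\
  forall bY', admissible bY' -> (kq bY.1 bY.2 <= kq bY'.1 bY'.2)%E.

(* powR takes the value 1 at a negative base; the convention 0 used here makes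
   the requirement Ytilde > 0 equivalent to the positivity of the base. *)
Definition Ytilde (lambda : 'cV[R]_d) (x : 'cV[R]_d) : R :=
  let a := (q - 1) * dot lambda x + 1 in
  if 0 < a then a `^ (q - 1)^-1 else 0.

Definition condition_C (lambda : 'cV[R]_d) : Prop :=
  {ae K, forall x, 0 < Ytilde lambda x} /\
  martingale_condition lambda (Ytilde lambda).

End problem.

(* Main.v *)
Require Import Defs.
From mathcomp Require Import all_boot all_order all_algebra.
From mathcomp Require Import all_classical all_reals all_analysis.
From mathcomp Require Import measurable_realfun ring lra.
Import Order.TTheory GRing.Theory Num.Theory.
Import numFieldNormedType.Exports.
Local Open Scope classical_set_scope.
Local Open Scope ring_scope.

(** The problem is convex, and Ytilde is the function for which the Lagrange
    condition holds pointwise with multiplier proportional to lambda: since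
    Ytilde ^ (q - 1) = (q - 1) lambda.x + 1, one has
      g_q'(Ytilde(x)) = q (q - 1) lambda.x.

    Minimality.  Let (beta, Y) be admissible.  The graph of g_q lies above its
    tangent at Ytilde(x) [gq_tangent], so that
      g_q(Y) - g_q(Ytilde) >= q (q - 1) lambda.(x Y - x Ytilde).
    The two martingale conditions give the integral of x Y - x Ytilde as
    c (lambda - beta); hence the jump parts of the functional differ by at least
    q (q - 1) lambda.c (lambda - beta) [Rintegral_gq_le].  The quadratic parts
    differ by at least q (q - 1) lambda.c (beta - lambda), because c is
    nonnegative definite [psd_tangent].  The two bounds cancel.

    Admissibility.  What has to be shown is that g_q(Ytilde) is K-integrable.
    It is bounded by a multiple of |x Ytilde - h(x)| plus a multiple of
    min(1, |x|^2) [gq_Ytilde_le].  Where |x| <= 1, convexity gives this without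
    any expansion near 0: comparing the tangent at Ytilde(x) with g_q(1) = 0,
      0 <= g_q(Ytilde) <= q (q - 1) lambda.x (Ytilde - 1),
    and x (Ytilde - 1) is exactly x Ytilde - h(x).  Where |x| > 1, g_q(Ytilde)
    is affine in Ytilde and x Ytilde [gq_Ytilde], h vanishes and
    Ytilde <= |x| Ytilde. *)

(** * The convex function g_q *)

(** For q > 1 this is Young's inequality applied to r * 1 with exponent q. *)
Lemma bernoulli_powR (R : realType) (q r : R) :
  0 < r -> q < 0 \/ 1 < q -> 1 + q * (r - 1) <= r `^ q.
Proof.
have gt1 (p s : R) : 0 < s -> 1 < p -> 1 + p * (s - 1) <= s `^ p.
  move=> s0 p1.
  have p0 : 0 < p by lra.
  have c0 : 0 < 1 - p^-1 by rewrite subr_gt0 invf_lt1.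
  have := @conjugate_powR _ s 1 p (1 - p^-1)^-1 (ltW s0) ler01 p0.
  rewrite invr_gt0 invrK => /(_ c0); rewrite subrKC => /(_ erefl).
  rewrite powR1 mulr1 mul1r => h.
  have : p * s <= p * (s `^ p / p + (1 - p^-1)) by rewrite ler_pM2l.
  rewrite mulrDr mulrBr mulr1 mulfV ?gt_eqF// mulrCA mulfV ?gt_eqF// mulr1.
  lra.
move=> r0 [q0|q1]; last exact: gt1.
(* r ^ q = r * (1 / r) ^ (1 - q) reduces negative exponents to 1 - q > 1. *)
have ri0 : 0 < r^-1 by rewrite invr_gt0.
have q1 : 1 < 1 - q by lra.
have := gt1 (1 - q) r^-1 ri0 q1.
have r_ge0 := ltW r0.
rewrite -{2}(powR_inv1 r_ge0) -powRrM mulN1r opprB powRB ?lt0r_neq0 ?implybT//.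
rewrite powRr1// ler_pdivlMr// => h.
have e : (1 + (1 - q) * (r^-1 - 1)) * r = 1 + q * (r - 1).
  by field; rewrite gt_eqF.
by rewrite -e.
Qed.

(** Convexity of g_q, by scaling: Bernoulli's inequality at the ratio y / z,
    multiplied by z ^ q. *)
Lemma gq_tangent (R : realType) (q y z : R) :
  q < 0 \/ 1 < q -> 0 < y -> 0 < z ->
  q * (z `^ (q - 1) - 1) * (y - z) <= gq q y - gq q z.
Proof.
move=> hq y0 z0.
have zq : z `^ q = z * z `^ (q - 1).
  rewrite powRB ?lt0r_neq0 ?implybT// powRr1 ?ltW//.
  by rewrite mulrCA mulfV ?mulr1// gt_eqF.
have yz0 : 0 < y / z by rewrite divr_gt0.
have := bernoulli_powR R q (y / z) yz0 hq.
rewrite -(ler_pM2r (powR_gt0 q z0)) -(powRM q (ltW yz0) (ltW z0)).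
rewrite divfK ?gt_eqF// zq.
have -> : (1 + q * (y / z - 1)) * (z * z `^ (q - 1)) =
  z * z `^ (q - 1) + q * z `^ (q - 1) * (y - z).
  by field; rewrite gt_eqF.
rewrite /gq zq; nra.
Qed.

Lemma gq1 (R : realType) (q : R) : gq q 1 = 0.
Proof. by rewrite /gq powR1; ring. Qed.

Lemma gq_ge0 (R : realType) (q y : R) :
  q < 0 \/ 1 < q -> 0 < y -> 0 <= gq q y.
Proof.
move=> hq y0; have := gq_tangent R q y 1 hq y0 ltr01.
by rewrite gq1 powR1 subrr mulr0 mul0r subr0.
Qed.

(** The first-order condition that characterizes Ytilde: it says that
    g_q'(Ytilde(x)) = q (q - 1) lambda.x. *)
Lemma Ytilde_powR (R : realType) (d : nat) (q : R) (l x : 'cV[R]_d) :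
  q != 1 -> 0 < Ytilde q l x ->
  Ytilde q l x `^ (q - 1) = (q - 1) * dot l x + 1.
Proof.
move=> q1; rewrite /Ytilde; case: ifPn => [a0 _|_]; last by rewrite ltxx.
by rewrite -powRrM mulVf ?subr_eq0// powRr1 ?ltW.
Qed.

(** The relation Ytilde ^ q = Ytilde * Ytilde ^ (q - 1) removes the power, so
    that the integrand becomes affine in Ytilde and x Ytilde, the quantities
    controlled by the martingale condition. *)
Lemma gq_Ytilde (R : realType) (d : nat) (q : R) (l x : 'cV[R]_d) :
  q != 1 -> 0 < Ytilde q l x ->
  gq q (Ytilde q l x) =
  (q - 1) * (dot l x * Ytilde q l x - Ytilde q l x + 1).
Proof.
move=> q1 y0.
have e := Ytilde_powR _ _ _ _ _ q1 y0.
rewrite powRB ?lt0r_neq0 ?implybT// powRr1 ?ltW// in e.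
rewrite /gq.
have -> : Ytilde q l x `^ q = Ytilde q l x * ((q - 1) * dot l x + 1).
  by rewrite -e mulrCA mulfV ?mulr1// gt_eqF.
ring.
Qed.

(** * Euclidean space *)

Lemma dotDr (R : realType) (d : nat) (l u v : 'cV[R]_d) :
  dot l (u + v) = dot l u + dot l v.
Proof.
by rewrite /dot -big_split; apply: eq_bigr => i _; rewrite !mxE mulrDr.
Qed.

Lemma dotZr (R : realType) (d : nat) (a : R) (l u : 'cV[R]_d) :
  dot l (a *: u) = a * dot l u.
Proof.
by rewrite /dot mulr_sumr; apply: eq_bigr => i _; rewrite !mxE mulrCA.
Qed.

Lemma dotC (R : realType) (d : nat) (l u : 'cV[R]_d) : dot l u = dot u l.
Proof. by apply: eq_bigr => i _; rewrite mulrC. Qed.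

Lemma dotBr (R : realType) (d : nat) (l u v : 'cV[R]_d) :
  dot l (u - v) = dot l u - dot l v.
Proof. by rewrite dotDr -scaleN1r dotZr mulN1r. Qed.

Lemma dot_mulmx (R : realType) (d : nat) (c : 'M[R]_d) (u v : 'cV[R]_d) :
  dot u (c *m v) = (u^T *m c *m v) ord0 ord0.
Proof.
by rewrite -mulmxA [RHS]mxE; apply: eq_bigr => i _; rewrite [u^T _ _]mxE.
Qed.

Lemma dot_sym (R : realType) (d : nat) (c : 'M[R]_d) (u v : 'cV[R]_d) :
  c^T = c -> dot u (c *m v) = dot v (c *m u).
Proof.
move=> cT; rewrite !dot_mulmx -[in RHS](trmxK (v^T *m c *m u)) [RHS]mxE.
by rewrite !trmx_mul trmxK cT mulmxA.
Qed.

Lemma enorm_ge0 (R : realType) (d : nat) (x : 'cV[R]_d) : 0 <= enorm x.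
Proof. exact: sqrtr_ge0. Qed.

Lemma enormZ (R : realType) (d : nat) (a : R) (x : 'cV[R]_d) :
  enorm (a *: x) = `|a| * enorm x.
Proof.
by rewrite /enorm dotZr dotC dotZr mulrA -expr2 sqrtrM ?sqr_ge0// sqrtr_sqr.
Qed.

Lemma coord_le_enorm (R : realType) (d : nat) (x : 'cV[R]_d) (i : 'I_d) :
  `|x i ord0| <= enorm x.
Proof.
rewrite -sqrtr_sqr ler_wsqrtr// /dot (bigD1 i)//= expr2 lerDl.
by apply: sumr_ge0 => j _; rewrite -expr2 sqr_ge0.
Qed.

Lemma dot_le_enorm (R : realType) (d : nat) (l x : 'cV[R]_d) :
  `|dot l x| <= (\sum_(i < d) `|l i ord0|) * enorm x.
Proof.
rewrite /dot mulr_suml (le_trans (ler_norm_sum _ _ _))// ler_sum// => i _.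
by rewrite normrM ler_wpM2l// coord_le_enorm.
Qed.

(** * Measurability *)

Lemma continuous_measurable_mx (R : realType) (m n : nat)
    (f : 'M[R]_(m, n) -> R) : continuous f -> measurable_fun setT f.
Proof.
move=> /continuousP cf.
apply: (measurability _ (RGenOpens.measurableE R)).
move=> _ [_ [a [b ->] <-]]; rewrite setTI.
by apply: sub_sigma_algebra; apply: cf; exact: interval_open.
Qed.

Lemma measurable_coord (R : realType) (d : nat) (i : 'I_d) :
  measurable_fun setT (fun x : 'cV[R]_d => x i ord0).
Proof. by apply: continuous_measurable_mx => x; exact: coord_continuous. Qed.

Lemma measurable_dot (R : realType) (d : nat) (l : 'cV[R]_d) :
  measurable_fun setT (dot l).
Proof.
apply: measurable_sum => i; apply: measurable_funM => //.
exact: measurable_coord.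
Qed.

(** Measurability of F is asked coordinatewise, which avoids comparing the Borel
    sigma-algebra of R^d with the product one. *)
Lemma measurable_enorm dT (T : measurableType dT) (R : realType) (d : nat)
    (F : T -> 'cV[R]_d) :
  (forall i, measurable_fun setT (fun x => F x i ord0)) ->
  measurable_fun setT (fun x => enorm (F x)).
Proof.
move=> mF; have msqrt : measurable_fun setT (@Num.sqrt R).
  by apply: continuous_measurable_fun; exact: sqrt_continuous.
apply: (measurableT_comp msqrt).
by apply: measurable_sum => i; apply: measurable_funM.
Qed.

Lemma measurable_trunc (R : realType) (d : nat) (i : 'I_d) :
  measurable_fun setT (fun x : 'cV[R]_d => trunc x i ord0).
Proof.
rewrite (_ : (fun _ => _) = fun x : 'cV[R]_d =>
    if enorm x <= 1 then x i ord0 else 0); last first.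
  by apply/funext => x; rewrite /trunc; case: ifP; rewrite ?mxE.
apply: measurable_fun_ifT => //; last exact: measurable_coord.
apply: measurable_fun_ler => //; apply: measurable_enorm => j.
exact: measurable_coord.
Qed.

Lemma measurable_compensated (R : realType) (d : nat) (Y : 'cV[R]_d -> R)
    (i : 'I_d) : measurable_fun setT Y ->
  measurable_fun setT (fun x => (Y x *: x - trunc x) i ord0).
Proof.
move=> mY.
rewrite (_ : (fun _ => _) = (fun x => Y x * x i ord0 - trunc x i ord0)).
  apply: measurable_funB; last exact: measurable_trunc.
  by apply: measurable_funM => //; exact: measurable_coord.
by apply/funext => x; rewrite !mxE.
Qed.

Lemma measurable_Ytilde (R : realType) (d : nat) (q : R) (l : 'cV[R]_d) :
  measurable_fun setT (Ytilde q l).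
Proof.
have ma : measurable_fun setT (fun x => (q - 1) * dot l x + 1).
  apply: measurable_funD => //; apply: measurable_funM => //.
  exact: measurable_dot.
apply: measurable_fun_ifT => //; first exact: measurable_fun_ltr.
by apply: (measurableT_comp (measurable_powR _)).
Qed.

Lemma measurable_gq dT (T : measurableType dT) (R : realType) (q : R)
    (Y : T -> R) :
  measurable_fun setT Y -> measurable_fun setT (fun x => gq q (Y x)).
Proof.
move=> mY; apply: measurable_funB; last first.
  by apply: measurable_funM => //; exact: measurable_funB.
apply: measurable_funB => //.
by apply: (measurableT_comp (measurable_powR _)).
Qed.

(** * Integration *)

Lemma ae_le_integrable dT (T : measurableType dT) (R : realType)
    (mu : {measure set T -> \bar R}) (f g : T -> R) :
  measurable_fun setT f -> mu.-integrable setT (EFin \o g) ->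
  {ae mu, forall x, `|f x| <= `|g x|} -> mu.-integrable setT (EFin \o f).
Proof.
move=> mf /integrableP[mg goo] fg; apply/integrableP; split.
  exact/measurable_EFinP.
apply: le_lt_trans goo; apply: ae_ge0_le_integral => //.
- by apply: measurableT_comp => //; exact/measurable_EFinP.
- exact: measurableT_comp.
- by apply: filterS fg => x h _; rewrite /= lee_fin.
Qed.

Lemma ae_Rintegral_ge0 dT (T : measurableType dT) (R : realType)
    (mu : {measure set T -> \bar R}) (f : T -> R) :
  mu.-integrable setT (EFin \o f) -> {ae mu, forall x, 0 <= f x} ->
  0 <= \int[mu]_x f x.
Proof.
move=> /integrableP[mf _] f0; rewrite /Rintegral.
rewrite (@ae_eq_integral _ _ _ mu setT (fun x => `|(f x)%:E|%E))//.
- by apply: fine_ge0; apply: integral_ge0.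
- exact: measurableT_comp.
- by apply: filterS f0 => x h _; rewrite /= ger0_norm.
Qed.

Lemma ae_ge0_integrable dT (T : measurableType dT) (R : realType)
    (mu : {measure set T -> \bar R}) (f : T -> R) :
  measurable_fun setT f -> {ae mu, forall x, 0 <= f x} ->
  (\int[mu]_x (f x)%:E < +oo)%E -> mu.-integrable setT (EFin \o f).
Proof.
move=> /measurable_EFinP mf f0 foo; apply/integrableP; split => //.
rewrite (@ae_eq_integral _ _ _ mu setT (fun x => (f x)%:E))//.
- exact: measurableT_comp.
- by apply: filterS f0 => x h _; rewrite /= ger0_norm.
Qed.

Lemma integrable_coord dT (T : measurableType dT) (R : realType) (d : nat)
    (mu : {measure set T -> \bar R}) (F : T -> 'cV[R]_d) (i : 'I_d) :
  (forall i, measurable_fun setT (fun x => F x i ord0)) ->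
  (\int[mu]_x (enorm (F x))%:E < +oo)%E ->
  mu.-integrable setT (EFin \o (fun x => F x i ord0)).
Proof.
move=> mF Foo; apply: (ae_le_integrable _ _ _ _ _ (fun x => enorm (F x))) => //.
  apply: ae_ge0_integrable => //; first exact: measurable_enorm.
  by apply: aeW => x; exact: enorm_ge0.
by apply: aeW => x; rewrite (ger0_norm (enorm_ge0 _ _ _)) coord_le_enorm.
Qed.

Lemma integrable_dot dT (T : measurableType dT) (R : realType) (d : nat)
    (mu : {measure set T -> \bar R}) (l : 'cV[R]_d) (F : T -> 'cV[R]_d) :
  (forall i, mu.-integrable setT (EFin \o (fun x => F x i ord0))) ->
  mu.-integrable setT (EFin \o (fun x => dot l (F x))).
Proof.
move=> iF; rewrite (_ : _ \o _ =
  fun x => (\sum_(i < d) ((l i ord0)%:E * (F x i ord0)%:E))%E); last first.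
  by apply/funext => x; rewrite /= /dot -sumEFin.
by apply: integrable_sum => // i _; exact: (integrableZl measurableT (l i ord0) (iF i)).
Qed.

Lemma Rintegral_dot dT (T : measurableType dT) (R : realType) (d : nat)
    (mu : {measure set T -> \bar R}) (l : 'cV[R]_d) (F : T -> 'cV[R]_d) :
  (forall i, mu.-integrable setT (EFin \o (fun x => F x i ord0))) ->
  \int[mu]_x dot l (F x) = dot l (\col_i \int[mu]_x F x i ord0).
Proof.
move=> iF; have iZ i := integrableZl measurableT (l i ord0) (iF i).
rewrite /Rintegral /dot; under eq_integral do rewrite -sumEFin.
rewrite integral_sum//; apply: EFin_inj.
rewrite fineK; last first.
  by apply/sum_fin_numP => i _ _; exact: (integrable_fin_num measurableT (iZ i)).
rewrite /dot -sumEFin; apply: eq_bigr => i _.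
rewrite mxE -(RintegralZl _ _ (iF i))//.
by rewrite fineK//; exact: (integrable_fin_num measurableT (iZ i)).
Qed.


(** * Admissibility and minimality *)

(** The integrability of g_q(Ytilde): both terms on the right are K-integrable.
    The two regimes |x| <= 1 and |x| > 1 call for different arguments, and the
    constant is large enough for both. *)
Lemma gq_Ytilde_le (R : realType) (d : nat) (q : R) (l x : 'cV[R]_d) :
  q < 0 \/ 1 < q -> 0 < Ytilde q l x ->
  `|gq q (Ytilde q l x)| <=
    (`|q - 1| * ((`|q| + 1) * (\sum_(i < d) `|l i ord0|) + 1)) *
      enorm (Ytilde q l x *: x - trunc x) +
    `|q - 1| * Num.min 1 (enorm x ^+ 2).
Proof.
move=> hq y0; have q1 : q != 1 by apply/eqP; lra.
set M := \sum_(i < d) _; set y := Ytilde q l x in y0 *.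
have M0 : 0 <= M by apply: sumr_ge0.
have A0 := normr_ge0 (q - 1); have Q0 := normr_ge0 q.
have x0 := enorm_ge0 _ _ x.
rewrite /trunc; case: ifPn => [_|]; last rewrite -ltNge => x1.
  (* On the unit ball, the tangent at Ytilde(x) is compared with g_q(1) = 0. *)
- have m0 : 0 <= Num.min 1 (enorm x ^+ 2) by rewrite le_min ler01 sqr_ge0.
  rewrite ger0_norm; last exact: gq_ge0.
  have -> : y *: x - x = (y - 1) *: x by rewrite scalerBl scale1r.
  set w := (y - 1) *: x.
  have w0 := enorm_ge0 _ _ w.
  have : gq q y <= q * (q - 1) * dot l w.
    have := gq_tangent _ _ _ _ hq ltr01 y0.
    by rewrite gq1 Ytilde_powR// /w dotZr; lra.
  move=> /le_trans; apply.
  apply: (le_trans (ler_norm _)); rewrite !normrM.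
  have := ler_wpM2l (mulr_ge0 Q0 A0) (dot_le_enorm _ _ l w).
  have : 0 <= `|q - 1| * (M + 1) * enorm w by rewrite !mulr_ge0// addr_ge0.
  have := mulr_ge0 A0 m0.
  rewrite -/M; lra.
  (* Outside the unit ball, Ytilde is dominated by |x| Ytilde. *)
- rewrite subr0 gq_Ytilde// -/y normrM.
  have -> : Num.min 1 (enorm x ^+ 2) = 1.
    by apply/min_idPl; rewrite expr_ge1// ltW.
  set w := y *: x.
  have yw : y <= enorm w.
    by rewrite enormZ gtr0_norm// ler_peMr// ltW.
  have w0 := enorm_ge0 _ _ w.
  have e : dot l x * y = dot l w by rewrite dotZr mulrC.
  have h : `|dot l x * y - y + 1| <= M * enorm w + enorm w + 1.
    rewrite e; have := dot_le_enorm _ _ l w; rewrite -/M !ler_norml.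
    by move=> /andP[? ?]; apply/andP; split; lra.
  have := ler_wpM2l A0 h.
  have : 0 <= `|q - 1| * `|q| * M * enorm w by rewrite !mulr_ge0.
  lra.
Qed.

Lemma integrable_compensated (R : realType) (d : nat) (b : 'cV[R]_d)
    (c : 'M[R]_d) (K : {measure set 'cV[R]_d -> \bar R}) (l : 'cV[R]_d)
    (Y : 'cV[R]_d -> R) (i : 'I_d) :
  measurable_fun setT Y -> martingale_condition b c K l Y ->
  K.-integrable setT (EFin \o (fun x => (Y x *: x - trunc x) i ord0)).
Proof.
move=> mY [Yoo _]; apply: (integrable_coord _ _ _ _ _ _ i _ Yoo) => j.
exact: measurable_compensated.
Qed.

Lemma integrable_gq_Ytilde (R : realType) (d : nat) (b : 'cV[R]_d)
    (c : 'M[R]_d) (K : {measure set 'cV[R]_d -> \bar R}) (q : R)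
    (l : 'cV[R]_d) :
  q < 0 \/ 1 < q -> levy_measure K -> condition_C b c K q l ->
  K.-integrable setT (EFin \o (fun x => gq q (Ytilde q l x))).
Proof.
move=> hq [_ Koo] [Y0 [Yoo _]].
have mY := measurable_Ytilde _ _ q l.
set C := `|q - 1| * ((`|q| + 1) * (\sum_(i < d) `|l i ord0|) + 1).
pose N := fun x => enorm (Ytilde q l x *: x - trunc x).
pose m := fun x : 'cV[R]_d => Num.min 1 (enorm x ^+ 2).
have iN : K.-integrable setT (EFin \o N).
  apply: ae_ge0_integrable => //.
    by apply: measurable_enorm => i; exact: measurable_compensated.
  by apply: aeW => x; exact: enorm_ge0.
have im : K.-integrable setT (EFin \o m).
  apply: ae_ge0_integrable => //.
    apply: measurable_minr => //; apply: measurable_funX.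
    by apply: measurable_enorm => i; exact: measurable_coord.
  by apply: aeW => x; rewrite le_min ler01 sqr_ge0.
apply: (ae_le_integrable _ _ _ _ _ (fun x => C * N x + `|q - 1| * m x)).
- exact: measurable_gq.
- exact: (integrableD measurableT (integrableZl measurableT C iN)
    (integrableZl measurableT `|q - 1| im)).
- apply: filterS Y0 => x x0.
  exact: (le_trans (gq_Ytilde_le _ _ _ _ _ hq x0) (ler_norm _)).
Qed.

(** Only the value +oo has to be excluded for the integral of g_q(Y), as g_q is
    nonnegative on the positive half-line; at y = 0 it may be negative, hence
    the argument up to null sets. *)
Lemma integrable_gq_admissible (R : realType) (d : nat) (b : 'cV[R]_d)
    (c : 'M[R]_d) (K : {measure set 'cV[R]_d -> \bar R}) (q : R)
    (beta : 'cV[R]_d) (Y : 'cV[R]_d -> R) :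
  q < 0 \/ 1 < q -> admissible b c K q (beta, Y) ->
  K.-integrable setT (EFin \o (fun x => gq q (Y x))).
Proof.
move=> hq [/= mY _ Y0 koo _]; apply: ae_ge0_integrable.
- exact: measurable_gq.
- by apply: filterS Y0 => x; exact: gq_ge0.
- by move: koo; rewrite /kq; case: (\int[K]_x _)%E => [r _| |]//=; rewrite ltry.
Qed.

Lemma kq_fin (R : realType) (d : nat) (c : 'M[R]_d)
    (K : {measure set 'cV[R]_d -> \bar R}) (q : R) (beta : 'cV[R]_d)
    (Y : 'cV[R]_d -> R) :
  K.-integrable setT (EFin \o (fun x => gq q (Y x))) ->
  kq c K q beta Y = (q * (q - 1) / 2 * dot beta (c *m beta) +
    \int[K]_x gq q (Y x))%:E.
Proof.
move=> i; rewrite /kq EFinD; congr (_ + _)%E.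
by rewrite fineK//; exact: (integrable_fin_num measurableT i).
Qed.

Lemma Ytilde_ge0 (R : realType) (d : nat) (q : R) (l x : 'cV[R]_d) :
  0 <= Ytilde q l x.
Proof. by rewrite /Ytilde; case: ifP => // _; exact: powR_ge0. Qed.

(** The quadratic form of c lies above its tangent at l, the difference being its
    value at u - l. *)
Lemma psd_tangent (R : realType) (d : nat) (c : 'M[R]_d) (l u : 'cV[R]_d) :
  sym_psd c ->
  2 * dot l (c *m (u - l)) <= dot u (c *m u) - dot l (c *m l).
Proof.
move=> [cT c0]; have := c0 (u - l).
rewrite mulmxBr !dotBr ![dot (u - l) _]dotC !dotBr.
rewrite ![dot (c *m _) _]dotC (dot_sym _ _ _ u l cT); lra.
Qed.

(** The tangent inequality of g_q, integrated: the linear term is evaluated by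
    subtracting the two martingale conditions, in which b and the truncation h
    cancel. *)
Lemma Rintegral_gq_le (R : realType) (d : nat) (b : 'cV[R]_d)
    (c : 'M[R]_d) (K : {measure set 'cV[R]_d -> \bar R}) (q : R)
    (l beta : 'cV[R]_d) (Y : 'cV[R]_d -> R) :
  q < 0 \/ 1 < q -> levy_measure K -> condition_C b c K q l ->
  admissible b c K q (beta, Y) ->
  q * (q - 1) * dot l (c *m (l - beta)) <=
    \int[K]_x gq q (Y x) - \int[K]_x gq q (Ytilde q l x).
Proof.
move=> hq K_levy Cq aY; have q1 : q != 1 by apply/eqP; lra.
have igt := integrable_gq_Ytilde _ _ _ _ _ _ _ hq K_levy Cq.
have ig := integrable_gq_admissible _ _ _ _ _ _ _ _ hq aY.
case: (Cq) => Yt0 Mt; case: aY => /= mY _ Y0 _ M.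
(* Y(x) x and Ytilde(x) x need not be integrable separately; their
   compensated versions F and G are. *)
pose F x := Y x *: x - trunc x; pose G x := Ytilde q l x *: x - trunc x.
have iF i : K.-integrable setT (EFin \o (fun x => F x i ord0)).
  exact: integrable_compensated M.
have iG i : K.-integrable setT (EFin \o (fun x => G x i ord0)).
  by apply: integrable_compensated Mt; exact: measurable_Ytilde.
have iH : K.-integrable setT (EFin \o (fun x => dot l (F x) - dot l (G x))).
  exact: (integrableB measurableT (integrable_dot _ _ _ _ _ l _ iF)
    (integrable_dot _ _ _ _ _ l _ iG)).
have -> : dot l (c *m (l - beta)) = \int[K]_x (dot l (F x) - dot l (G x)).
  rewrite RintegralB//; [|exact: integrable_dot..].
  rewrite !Rintegral_dot// -dotBr; congr (dot l _).
  case: M => _ /addr0_eq; case: Mt => _ /addr0_eq.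
  rewrite /vec_integral => <- <-.
  by rewrite opprK opprD addrACA addNr add0r mulmxBr addrC.
have iB := integrableB measurableT ig igt.
have iZ := integrableZl measurableT (q * (q - 1)) iH.
rewrite -(RintegralZl _ _ iH)// -(RintegralB _ ig igt)// -subr_ge0.
rewrite -(RintegralB _ iB iZ)//.
apply: ae_Rintegral_ge0; first exact: (integrableB measurableT iB iZ).
apply: filterS2 Y0 Yt0 => x y0 yt0; rewrite subr_ge0.
rewrite (le_trans _ (gq_tangent _ _ _ _ hq y0 yt0))// Ytilde_powR//.
by rewrite /F /G !dotBr !dotZr; lra.
Qed.

Theorem theorem2p9 (R : realType) (d : nat) (d_gt0 : (0 < d)%N)
    (dO : measure_display) (Omega : measurableType dO) (P : probability Omega R)
    (T : R) (T_gt0 : 0 < T)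
    (L : R -> Omega -> 'cV[R]_d)
    (filtered : forall t : R, 0 <= t <= T ->
       augmented_filtration P L t `<=` measurable)
    (L_levy : levy_process P (augmented_filtration P L) T L)
    (b : 'cV[R]_d) (c : 'M[R]_d) (K : {measure set 'cV[R]_d -> \bar R})
    (c_psd : sym_psd c) (K_levy : levy_measure K)
    (L_triplet : levy_triplet P T L b c K)
    (S : R -> Omega -> 'cV[R]_d)
    (S_exp : forall i, stoch_exponential P (augmented_filtration P L) T
                         (coordinate L i) (coordinate S i))
    (L_jumps : {ae P, forall w, forall (i : 'I_d) (t : R), 0 < t <= T ->
                        -1 < jump (fun s => coordinate L i s w) t})
    (q : R) (q_range : q < 0 \/ 1 < q)
    (Qq_neq0 : finite_fq_lmm P (augmented_filtration P L) T S q !=set0)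
    (lambda : 'cV[R]_d) (C_q : condition_C b c K q lambda) :
  solves b c K q (lambda, Ytilde q lambda).
Proof.
have q0 : 0 < q * (q - 1) by case: q_range => ?; nra.
have ig := integrable_gq_Ytilde _ _ _ _ _ _ _ q_range K_levy C_q.
case: (C_q) => Y0 M; split.
  split => //=.
  - exact: measurable_Ytilde.
  - by move=> x; exact: Ytilde_ge0.
  - by rewrite kq_fin// ltry.
move=> [beta Y] aY /=.
rewrite !kq_fin//; last exact: integrable_gq_admissible aY.
rewrite lee_fin.
have := Rintegral_gq_le _ _ _ _ _ _ _ _ _ q_range K_levy C_q aY.
have := ler_wpM2l (ltW q0) (psd_tangent _ _ _ lambda beta c_psd).
rewrite !mulmxBr !dotBr; lra.
Qed.
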